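(* Let $\mu_m=\dfrac{(aq;q)_m}{(abq^2;q)_m}$ for integers $m\ge 0$. Let $n$ be a positive integer. Then $$\det\left(\mu_{i+j}\right)_{0\le i,j\le n-1}=a^{\frac12 n(n-1)}\,q^{\frac16 n(n-1)(2n-1)}\prod_{k=1}^{n}\frac{(q;q)_{n-k}\,(aq;q)_{n-k}\,(bq;q)_{n-k}}{(abq^{n-k+1};q)_{n-k}\,(abq^{2};q)_{2(n-k)}}.$$
   Context: Here $a,b,q$ are indeterminates, and the identity is an identity of rational functions in $a,b,q$. For a nonnegative integer $m$, the $q$-shifted factorial is $(x;q)_m=\prod_{k=0}^{m-1}(1-xq^k)$, with $(x;q)_0=1$. *)

(* Defs.v *)
From HB Require Import structures.
From mathcomp Require Import all_boot all_order all_algebra.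
From mathcomp Require Import mpoly.

Set Implicit Arguments.
Unset Strict Implicit.
Unset Printing Implicit Defensive.

Import GRing.Theory.
Local Open Scope ring_scope.

Definition qpoch (R : comNzRingType) (x q : R) (m : nat) : R :=
  \prod_(k < m) (1 - x * q ^+ k).

(* K(a, b, q), with a = 'X_0, b = 'X_1, q = 'X_2. *)
Definition ratfun3 (K : fieldType) : fieldType := {fraction {mpoly K[3]}}.

Definition indet (K : fieldType) (i : 'I_3) : ratfun3 K :=
  tofrac ('X_i : {mpoly K[3]}).

Definition mu (F : fieldType) (a b q : F) (m : nat) : F :=
  qpoch (a * q) q m / qpoch (a * b * q ^+ 2) q m.

(* Main.v *)
(* With A = aq, C = abq^2 and N = n - 1, pulling (A;q)_i / (C;q)_{i+N} out of
   row i leaves p_j(q^i), where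
     p_j(x) = prod_{k<j} (1 - A q^k x) * prod_{j<=k<N} (1 - C q^k x).
   Hence the determinant is a Vandermonde determinant in the q^i times the
   determinant of the coefficients of the p_j.  For arbitrary parameters alpha_k,
   gamma_k in place of A q^k, C q^k, the latter is the product of
   gamma_k - alpha_j over j <= k < N (Krattenthaler): successive differences
   p_{j+1} - p_j are (gamma_j - alpha_j) x times the same polynomials of one
   degree less, with the gammas shifted, while p_j(0) = 1. *)

Require Import Defs.
From HB Require Import structures.
From mathcomp Require Import all_boot all_order all_algebra.
From mathcomp Require Import mpoly ring zify.

Import GRing.Theory.
Local Open Scope ring_scope.

Section MixedProducts.
Variable R : comNzRingType.
Implicit Types (alpha gamma : nat -> R) (N : nat).

Definition mixed_prod alpha gamma N (j : nat) : {poly R} :=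
  \prod_(k < N) (1 - (if (k < j)%N then alpha k else gamma k) *: 'X).

Lemma size_mixed_prod alpha gamma N j :
  (size (mixed_prod alpha gamma N j) <= N.+1)%N.
Proof.
rewrite /mixed_prod; elim: N => [|N IH]; first by rewrite big_ord0 size_poly1.
rewrite big_ord_recr /=; apply: leq_trans (size_polyMleq _ _) _.
set f := 1 - _; have f2 : (size f <= 2)%N; last first.
  by move: (leq_add IH f2); rewrite addn2; case: (_ + _)%N.
rewrite (leq_trans (size_polyD _ _))// size_polyN geq_max size_poly1.
by rewrite (leq_trans (size_scale_leq _ _)) ?size_polyX.
Qed.

Lemma mixed_prod_coef0 alpha gamma N j : (mixed_prod alpha gamma N j)`_0 = 1.
Proof.
rewrite -horner_coef0 horner_prod big1 // => k _.
by rewrite !hornerE; ring.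
Qed.

(** The two products differ only in the factor of index [j]. Once it is removed, the indices above
    [j] move down by one, which shifts [gamma]. *)
Lemma mixed_prod_diff alpha gamma N j : (j <= N)%N ->
  mixed_prod alpha gamma N.+1 j.+1 - mixed_prod alpha gamma N.+1 j =
  (gamma j - alpha j) *: (mixed_prod alpha (gamma \o succn) N j * 'X).
Proof.
rewrite -ltnS => lt_jN; pose jo := Ordinal lt_jN.
rewrite /mixed_prod !(bigD1_ord jo) //= ltnSn ltnn.
(* [bump j] skips the index [j], so the thresholds [j] and [j.+1] leave the same product. *)
have E (l : nat) : (j <= l <= j.+1)%N -> \prod_(i < N)
    (1 - (if (bump j i < l)%N then alpha (bump j i) else gamma (bump j i)) *: 'X)
  = \prod_(k < N) (1 - (if (k < j)%N then alpha k else gamma k.+1) *: 'X) :> {poly R}.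
  move=> /andP[le_jl le_lj]; apply: eq_bigr => k _.
  rewrite /bump; case: (leqP j k) => hjk; last by rewrite add0n ifT //; lia.
  by rewrite ifF //; lia.
rewrite !E ?leqnn ?leqnSn //; set P := \prod_(k < N) _.
by rewrite -mulrBl -!mul_polyC polyCB; ring.
Qed.

Lemma det_mixed_coef alpha gamma N :
  \det (\matrix_(i < N.+1, j < N.+1) (mixed_prod alpha gamma N j)`_i) =
  \prod_(j < N) \prod_(s < N - j) (gamma (j + s)%N - alpha j).
Proof.
elim: N gamma => [|N IH] gamma.
  by rewrite det_mx11 mxE mixed_prod_coef0 big_ord0.
set C := \matrix_(i, j) _.
(* Right multiplication by [1%:M - S] subtracts from each column its left neighbour and keeps column
   0. All constant terms being 1, the top row becomes (1, 0, ..., 0), and the lower right block is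
   the matrix [C'] for shifted [gamma] with columns scaled by [d]. *)
pose S : 'M[R]_N.+2 := \matrix_(i, j) (i.+1 == j)%:R.
pose d : 'rV[R]_N.+1 := \row_j (gamma j - alpha j).
pose C' : 'M[R]_N.+1 :=
  \matrix_(i, j) (mixed_prod alpha (gamma \o succn) N j)`_i.
have detU : \det (1%:M - S) = 1.
  rewrite -det_tr det_trig.
    by apply: big1 => i _; rewrite !mxE eqxx gtn_eqF // subr0.
  apply/is_trig_mxP => i j lt_ij; rewrite !mxE.
  have -> : (j == i) = false by apply/eqP => E; rewrite E ltnn in lt_ij.
  by rewrite gtn_eqF ?subr0 // ltnS ltnW.
have CS0 i : (C *m S) i ord0 = 0.
  by rewrite mxE big1 // => k _; rewrite !mxE mulr0.
have CSS i (j : 'I_N.+1) :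
    (C *m S) i (lift ord0 j) = (mixed_prod alpha gamma N.+1 j)`_i.
  rewrite mxE (bigD1 (widen_ord (leqnSn _) j)) //= big1 => [|k nk].
    by rewrite !mxE /= /bump /= add1n eqxx mulr1 addr0.
  rewrite !mxE /= /bump /= add1n eqSS; case: eqP => [E|]; rewrite ?mulr0 //.
  by case/eqP: nk; apply: val_inj.
have CU : C *m (1%:M - S) =
    block_mx 1%:M 0 (\col_(i < N.+1) C (lift ord0 i) ord0) (C' *m diag_mx d)
    :> 'M_(1 + N.+1).
  rewrite mulmxBr mulmx1; apply/matrixP => i j.
  case: (split_ordP i) => {}i ->; case: (split_ordP j) => {}j ->.
  - rewrite block_mxEul !ord1 lshift0 mxE [X in _ + X]mxE CS0 subr0 !mxE.
    by rewrite mixed_prod_coef0.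
  - rewrite block_mxEur !ord1 lshift0 rshift1 mxE [X in _ + X]mxE CSS !mxE.
    by rewrite !mixed_prod_coef0 subrr.
  - by rewrite block_mxEdl !ord1 lshift0 rshift1 mxE [X in _ + X]mxE CS0 subr0 !mxE.
  - rewrite block_mxEdr !rshift1 mxE [X in _ + X]mxE CSS !mxE /= /bump /= !add1n.
    rewrite -coefB mixed_prod_diff ?leq_ord // coefZ coefMX /=.
    rewrite (bigD1 j) //= big1 => [|k nk]; last first.
      by rewrite !mxE (negPf nk) mulr0n mulr0.
    by rewrite !mxE eqxx mulr1n addr0 mulrC.
rewrite -[LHS]mulr1 -[X in _ * X = _]detU -det_mulmx CU.
transitivity (\det (1%:M : 'M[R]_1) * \det (C' *m diag_mx d)).
  exact: (@det_lblock R 1 N.+1).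
rewrite det1 mul1r det_mulmx IH det_diag.
(* The entry [d 0 j] supplies the factor s = 0; the factors s > 0 come from the induction
   hypothesis, whose product is empty at j = N. *)
rewrite [in RHS](eq_bigr (fun j : 'I_N.+1 =>
  (\prod_(s < N - j) ((gamma \o succn) (j + s)%N - alpha j)) * d 0 j)); last first.
  move=> j _; rewrite subSn ?leq_ord // big_ord_recl addn0 [RHS]mulrC mxE.
  by congr (_ * _); apply: eq_bigr => s _; rewrite /= /bump /= add1n addnS.
by rewrite big_split [X in _ = X * _]big_ord_recr /= subnn big_ord0 mulr1.
Qed.

Lemma det_mixed_eval alpha gamma N (x : nat -> R) :
  \det (\matrix_(i < N.+1, j < N.+1) (mixed_prod alpha gamma N j).[x i]) =
  (\prod_(i < N.+1) \prod_(s < N - i) (x (i + s.+1)%N - x i)) *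
  \prod_(j < N) \prod_(s < N - j) (gamma (j + s)%N - alpha j).
Proof.
rewrite -det_mixed_coef.
pose V := Vandermonde N.+1 (\row_(i < N.+1) x i).
set C := \matrix_(i, j) _`_ _.
transitivity (\det (V^T *m C)).
  congr (\det _); apply/matrixP => i j; rewrite !mxE.
  rewrite (horner_coef_wide _ (size_mixed_prod alpha gamma N j)).
  by apply: eq_bigr => k _; rewrite !mxE mulrC.
rewrite det_mulmx det_tr det_Vandermonde; congr (_ * _).
apply: eq_bigr => i _.
under eq_bigr do rewrite !mxE.
(* The Vandermonde pairs i < j are indexed by their gap, j = i + s + 1. *)
rewrite -(big_geq_mkord _ _ xpredT (fun j => x j - x i)) -[i.+1]add0n big_addn.
by rewrite subSS big_mkord; apply: eq_bigr => s _; rewrite !addnS (addnC i).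
Qed.

Lemma mixed_prod_cat alpha gamma j m :
  mixed_prod alpha gamma (j + m) j =
  (\prod_(k < j) (1 - alpha k *: 'X)) *
  \prod_(k < m) (1 - gamma (j + k)%N *: 'X).
Proof.
rewrite /mixed_prod big_split_ord /=; congr (_ * _); apply: eq_bigr => k _.
  by rewrite ltn_ord.
by rewrite ltnNge leq_addr.
Qed.

End MixedProducts.

Section QShifted.
Variable R : comNzRingType.
Implicit Types x y c q : R.

Lemma qpochD x q m n :
  qpoch x q (m + n) = qpoch x q m * qpoch (x * q ^+ m) q n.
Proof.
rewrite /qpoch big_split_ord; congr (_ * _).
by apply: eq_bigr => k _; rewrite exprD mulrA.
Qed.

(** Serves both products of differences: c = q^i, x = q for the Vandermonde part, and c = A q^i, x =
    bq for the coefficient part, since C = A b q. *)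
Lemma prod_scaled_qpoch c x q m :
  \prod_(s < m) (c * (x * q ^+ s) - c) = (- c) ^+ m * qpoch x q m.
Proof.
rewrite -[X in _ ^+ X]card_ord -prodr_const -big_split /=.
by apply: eq_bigr => s _; ring.
Qed.

Lemma horner_mixed_qpoch x y q j m i :
  (mixed_prod R (fun k => x * q ^+ k) (fun k => y * q ^+ k) (j + m) j).[q ^+ i] =
  qpoch (x * q ^+ i) q j * qpoch (y * q ^+ (i + j)) q m.
Proof.
rewrite mixed_prod_cat hornerM !horner_prod.
congr (_ * _); apply: eq_bigr => k _; rewrite !hornerE ?exprD; ring.
Qed.

(** From N to N + 1 every exponent grows by one. The extra factor has q-exponent 1 + 3 + ... + (2N +
    1) = (N + 1)^2, so the q-exponents add up to a sum of squares. *)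
Lemma prod_triangular_powers x q N :
  \prod_(i < N.+1) (x * q ^+ (2 * i).+1) ^+ (N - i) =
  x ^+ ((N.+1 * N) %/ 2) * q ^+ ((N.+1 * N * (2 * N).+1) %/ 6).
Proof.
have odd_sum M : \prod_(i < M) (x * q ^+ (2 * i).+1) = x ^+ M * q ^+ (M * M).
  elim: M => [|M IH]; first by rewrite big_ord0 mulr1.
  rewrite big_ord_recr IH /= (_ : (M.+1 * M.+1 = M * M + (2 * M).+1)%N); last lia.
  by rewrite exprD [x ^+ M.+1]exprSr mulrACA.
elim: N => [|N IH]; first by rewrite big_ord_recr big_ord0 /= !mulr1.
rewrite big_ord_recr /= subnn mulr1.
under eq_bigr do rewrite subSn ?leq_ord // exprSr.
rewrite big_split /= IH odd_sum.
have -> : ((N.+2 * N.+1) %/ 2 = (N.+1 * N) %/ 2 + N.+1)%N.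
  by rewrite (_ : N.+2 * N.+1 = N.+1 * N + N.+1 * 2)%N ?divnDMl //; lia.
have -> : ((N.+2 * N.+1 * (2 * N.+1).+1) %/ 6 =
           (N.+1 * N * (2 * N).+1) %/ 6 + N.+1 * N.+1)%N.
  by rewrite (_ : N.+2 * N.+1 * _ = N.+1 * N * (2 * N).+1 + N.+1 * N.+1 * 6)%N
    ?divnDMl //; lia.
by rewrite !exprD; ring.
Qed.

(** Regroups the row denominators. From N to N + 1 the left side loses the length N and gains 2N + 1
    and 2N + 2; splitting the length 2N + 1 at N gives back the lost factor times
    [qpoch (x * q ^+ N.+2) q N.+1]. *)
Lemma prod_qpoch_double x q N :
  \prod_(i < N.+1) qpoch (x * q ^+ 2) q (i + N) =
  \prod_(m < N.+1) (qpoch (x * q ^+ m.+1) q m * qpoch (x * q ^+ 2) q (2 * m)).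
Proof.
elim: N => [|N IH]; first by rewrite !big_ord_recr !big_ord0 /= /qpoch !big_ord0 !mul1r.
rewrite [RHS]big_ord_recr /= -IH big_ord_recr [in LHS]big_ord_recr /=.
rewrite [in RHS]big_ord_recl /= add0n.
have -> : \prod_(i < N) qpoch (x * q ^+ 2) q (bump 0 i + N) =
          \prod_(i < N) qpoch (x * q ^+ 2) q (i + N.+1).
  by apply: eq_bigr => i _; rewrite /bump /= add1n addSnnS.
rewrite [in LHS]qpochD -(mulrA x) -exprD add2n.
by rewrite (_ : N.+1 + N.+1 = 2 * N.+1)%N; [ring | lia].
Qed.

End QShifted.

Lemma det_mu (F : fieldType) (a b q : F) N :
  (forall k, 1 - a * b * q ^+ k.+2 != 0) ->
  \det (\matrix_(i < N.+1, j < N.+1) mu a b q (i + j)) =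
  a ^+ ((N.+1 * N) %/ 2) * q ^+ ((N.+1 * N * (2 * N).+1) %/ 6) *
  \prod_(m < N.+1)
    (qpoch q q m * qpoch (a * q) q m * qpoch (b * q) q m /
     (qpoch (a * b * q ^+ m.+1) q m * qpoch (a * b * q ^+ 2) q (2 * m))).
Proof.
move=> nz; set A := a * q; set C := a * b * q ^+ 2.
have nzC i m : qpoch (C * q ^+ i) q m != 0.
  apply/prodf_neq0 => k _.
  by rewrite /C -!(mulrA (a * b)) -!exprD !addSn add0n nz.
pose P := \matrix_(i < N.+1, j < N.+1) (mixed_prod F (fun k => A * q ^+ k)
  (fun k => C * q ^+ k) N j).[q ^+ i].
pose d := \row_(i < N.+1) (qpoch A q i / qpoch C q (i + N)).
have -> : \matrix_(i < N.+1, j < N.+1) mu a b q (i + j) = diag_mx d *m P.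
  apply/matrixP => i j; rewrite mul_diag_mx !mxE.
  move: (nat_of_ord i) (nat_of_ord j) (leq_ord j) => {}i {}j le_jN.
  (* With N = j + m, the tail (C q^(i+j); q)_m of the row denominator cancels against the second
     factor of p_j(q^i), while (A; q)_i (A q^i; q)_j = (A; q)_(i+j). *)
  rewrite -(subnKC le_jN); move: (N - j)%N => m.
  rewrite horner_mixed_qpoch addnA /mu -/A -/C qpochD [in RHS](qpochD _ C).
  have /negPf nz1 := nzC (i + j)%N m.
  have := nzC 0 (i + j)%N; rewrite mulr1 => /negPf nz2.
  by field; rewrite nz1 nz2.
rewrite det_mulmx det_diag det_mixed_eval.
under eq_bigr do rewrite mxE.
rewrite prodf_div prod_qpoch_double.
have -> : \prod_(j < N) \prod_(s < N - j) (C * q ^+ (j + s) - A * q ^+ j) =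
  \prod_(i < N.+1) ((- (A * q ^+ i)) ^+ (N - i) * qpoch (b * q) q (N - i)).
  rewrite [RHS]big_ord_recr /= subnn /qpoch big_ord0 !mulr1.
  apply: eq_bigr => j _; rewrite -prod_scaled_qpoch; apply: eq_bigr => s _.
  by rewrite /C /A exprD; ring.
have -> : \prod_(i < N.+1) \prod_(s < N - i) (q ^+ (i + s.+1) - q ^+ i) =
  \prod_(i < N.+1) ((- q ^+ i) ^+ (N - i) * qpoch q q (N - i)).
  apply: eq_bigr => i _; rewrite -prod_scaled_qpoch.
  by apply: eq_bigr => s _; rewrite exprD exprS.
rewrite -big_split /= prodf_div.
(* The signs cancel in (-q^i)(-A q^i) = a q^(2i+1). The lengths N - i are written with [rev_ord] so
   that the product can be reversed. *)
rewrite [X in _ * X = _](eq_bigr (fun i : 'I_N.+1 =>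
  (a * q ^+ (2 * i).+1) ^+ (N - i) *
  (qpoch q q (rev_ord i) * qpoch (b * q) q (rev_ord i)))); last first.
  move=> i _; rewrite /= subSS mulrACA -exprMn; congr (_ ^+ _ * _).
  by rewrite mulrNN /A exprS mul2n -addnn exprD; ring.
rewrite [X in _ * X = _]big_split prod_triangular_powers.
rewrite -(reindex_inj (@rev_ord_inj N.+1) (P := xpredT)
  (F := fun m : 'I_N.+1 => qpoch q q m * qpoch (b * q) q m)) /=.
rewrite !big_split /=; ring.
Qed.

Theorem theorem1p1 (K : fieldType) (n : nat) (hn : (0 < n)%N) :
  let a : ratfun3 K := indet K (inord 0) in
  let b : ratfun3 K := indet K (inord 1) in
  let q : ratfun3 K := indet K (inord 2) in
  \det (\matrix_(i < n, j < n) mu a b q (i + j)) =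
    a ^+ ((n * (n - 1)) %/ 2) * q ^+ ((n * (n - 1) * (2 * n - 1)) %/ 6) *
    \prod_(1 <= k < n.+1)
      (qpoch q q (n - k) * qpoch (a * q) q (n - k) * qpoch (b * q) q (n - k) /
       (qpoch (a * b * q ^+ (n - k + 1)) q (n - k) *
        qpoch (a * b * q ^+ 2) q (2 * (n - k)))).
Proof.
move=> a b q; case: n hn => // N _.
rewrite det_mu; last first.
  (* The denominator factors are nonzero polynomials: setting all indeterminates to 0 gives 1. *)
  move=> k; rewrite /a /b /q /indet -tofracXn -!tofracM -tofrac1 -tofracB.
  rewrite tofrac_eq0; apply/eqP => /(congr1 (meval (fun=> 0))).
  rewrite mevalB meval1 !mevalM meval0 !mevalXU !mul0r subr0.
  by apply/eqP; rewrite oner_eq0.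
rewrite subn1 (_ : 2 * N.+1 - 1 = (2 * N).+1)%N; last lia.
congr (_ * _); rewrite big_add1 big_mkord /= (reindex_inj rev_ord_inj) /=.
by apply: eq_bigr => i _; rewrite addn1.
Qed.
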